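(* There exist a complex Hilbert space and two densely defined, unbounded, closed operators $B$ and $C$ on it such that $CB-BC$ is bounded and not closed, while $|C|B-B|C|$ is unbounded and closed.
   Context: Operators are linear maps $T$ defined on a linear subspace $D(T)$ of a Hilbert space $\mathcal H$ with values in $\mathcal H$. An operator $T$ is called bounded if there is a constant $M\ge 0$ with $\|Tx\|\le M\|x\|$ for all $x\in D(T)$ (boundedness is on its own domain, which need not be all of $\mathcal H$), and unbounded otherwise. It is closed if its graph is closed in $\mathcal H\oplus\mathcal H$. Products and differences have their natural domains $D(ST)=\{x\in D(T): Tx\in D(S)\}$ and $D(S-T)=D(S)\cap D(T)$. For a densely defined closed operator $C$, $|C|=(C^*C)^{1/2}$ is the unique positive self-adjoint square root of the positive self-adjoint operator $C^*C$. *)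

(* Defs.v *)
From HB Require Import structures.
From mathcomp Require Import all_boot all_order all_algebra.
From mathcomp Require Import sesquilinear.
From mathcomp.real_closed Require Import complex.
From mathcomp Require Import all_classical all_reals all_analysis.
Import Order.TTheory GRing.Theory Num.Theory.
Import numFieldNormedType.Exports.

Set Implicit Arguments.
Unset Strict Implicit.
Unset Printing Implicit Defensive.

Local Open Scope classical_set_scope.
Local Open Scope ring_scope.
Local Open Scope complex_scope.

(* The form [hdot] is linear in its first argument and conjugate-linear in    *)
(* the second one. The law [hdotE] says that the norm, and hence the topology *)
(* and the completeness, of the underlying space are those of [hdot].         *)
HB.mixin Record CompleteNormedModule_isHilbert (R : realType) H
    of CompleteNormedModule R[i] H := {
  hdot : {dot H for Num.conj};
  hdotE : forall x : H, `|x| ^+ 2 = hdot x x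
}.

#[short(type="hilbertType")]
HB.structure Definition Hilbert (R : realType) :=
  {H of CompleteNormedModule_isHilbert R H & CompleteNormedModule R[i] H}.

Section Operators.
Context {R : realType} {H : hilbertType R}.

(* The values of [opfun] outside [opdom] are junk: no definition below uses   *)
(* them, and operators are to be compared with [opeq].                        *)
Record operator := Operator {
  opdom : set H;
  opfun :> H -> H;
  opdom0 : opdom 0;
  opdomP : forall (a : R[i]) (x y : H),
    opdom x -> opdom y -> opdom (a *: x + y);
  opfunP : forall (a : R[i]) (x y : H),
    opdom x -> opdom y -> opfun (a *: x + y) = a *: opfun x + opfun y
}.

Definition opeq (S T : operator) : Prop :=
  opdom S = opdom T /\ forall x, opdom S x -> S x = T x.

Lemma opfun0 (T : operator) : T 0 = 0.
Proof.
have := opfunP (-1) (opdom0 T) (opdom0 T).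
by rewrite scaler0 addr0 scaleN1r addNr.
Qed.

Definition opmul_dom (S T : operator) : set H :=
  [set x | opdom T x /\ opdom S (T x)].

Lemma opmul_dom0 (S T : operator) : opmul_dom S T 0.
Proof. by split; [exact: opdom0 | rewrite opfun0; exact: opdom0]. Qed.

Lemma opmul_domP (S T : operator) (a : R[i]) (x y : H) :
  opmul_dom S T x -> opmul_dom S T y -> opmul_dom S T (a *: x + y).
Proof.
move=> [Tx STx] [Ty STy]; split; first exact: opdomP.
by rewrite opfunP//; exact: opdomP.
Qed.

Lemma opmul_funP (S T : operator) (a : R[i]) (x y : H) :
  opmul_dom S T x -> opmul_dom S T y ->
  S (T (a *: x + y)) = a *: S (T x) + S (T y).
Proof. by move=> [Tx STx] [Ty STy]; rewrite !opfunP. Qed.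

Definition opmul (S T : operator) : operator :=
  Operator (opmul_dom0 S T) (@opmul_domP S T) (@opmul_funP S T).

Definition opsub_dom (S T : operator) : set H := opdom S `&` opdom T.

Lemma opsub_dom0 (S T : operator) : opsub_dom S T 0.
Proof. by split; exact: opdom0. Qed.

Lemma opsub_domP (S T : operator) (a : R[i]) (x y : H) :
  opsub_dom S T x -> opsub_dom S T y -> opsub_dom S T (a *: x + y).
Proof. by move=> [Sx Tx] [Sy Ty]; split; exact: opdomP. Qed.

Lemma opsub_funP (S T : operator) (a : R[i]) (x y : H) :
  opsub_dom S T x -> opsub_dom S T y ->
  S (a *: x + y) - T (a *: x + y) = a *: (S x - T x) + (S y - T y).
Proof.
by move=> [Sx Tx] [Sy Ty]; rewrite !opfunP// scalerBr opprD addrACA.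
Qed.

Definition opsub (S T : operator) : operator :=
  Operator (opsub_dom0 S T) (@opsub_domP S T) (@opsub_funP S T).

Definition densely_defined (T : operator) : Prop := dense (opdom T).

Definition bounded_operator (T : operator) : Prop :=
  exists M : R, 0 <= M /\ forall x, opdom T x -> `|T x| <= M%:C * `|x|.

Definition graph (T : operator) : set (H * H) :=
  [set p | opdom T p.1 /\ p.2 = T p.1].

(* The product topology on [H * H] is the topology of the Hilbert sum.        *)
Definition closed_operator (T : operator) : Prop := closed (graph T).

(* For a densely defined [T] there is exactly one such [S] up to [opeq].      *)
Definition is_adjoint (T S : operator) : Prop :=
  (forall y, opdom S y <->
     exists z, forall x, opdom T x -> hdot (T x) y = hdot x z) /\
  (forall x y, opdom T x -> opdom S y -> hdot (T x) y = hdot x (S y)).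

Definition self_adjoint (T : operator) : Prop :=
  densely_defined T /\ is_adjoint T T.

(* The order of [R[i]] is partial: [0 <= z] entails that [z] is real.         *)
Definition positive_operator (T : operator) : Prop :=
  forall x, opdom T x -> 0 <= hdot (T x) x.

Definition is_positive_sqrt (S A : operator) : Prop :=
  [/\ self_adjoint A, positive_operator A & opeq (opmul A A) S].

(* [A] is |C|, the unique positive self-adjoint square root of C* C.          *)
Definition is_absolute_value (C A : operator) : Prop :=
  exists Cadj : operator,
    [/\ is_adjoint C Cadj,
        is_positive_sqrt (opmul Cadj C) A &
        forall A', is_positive_sqrt (opmul Cadj C) A' -> opeq A' A].

End Operators.
Arguments operator {R} H.

(* Main.v *)
Require Import Defs.
From HB Require Import structures.
From mathcomp Require Import all_boot all_order all_algebra.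
From mathcomp Require Import sesquilinear ring lra.
From mathcomp.real_closed Require Import complex.
From mathcomp Require Import all_classical all_reals all_analysis.
Import Order.TTheory GRing.Theory Num.Theory.
Import numFieldNormedType.Exports.

Set Implicit Arguments.
Unset Strict Implicit.
Unset Printing Implicit Defensive.

Local Open Scope classical_set_scope.
Local Open Scope ring_scope.

(** It suffices to take [B = C] for a suitable [C] that squares to zero. On the
    orthogonal sum of two copies of l2 let [A = diag(1, 3, 5, ...)] and
    [C = [[0, A], [0, 0]]], that is [C (x1, x2) = (A x2, 0)]. Then:
    - [C] is closed and densely defined, and unbounded as [A] is;
    - [C C = 0] on the domain of [C], since the range of [C] lies in its kernel.
      So [C B - B C] is the zero operator on a dense proper subspace: it is
      bounded, but it is not closed, since the limit of graph points [(x_n, 0)]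
      can have its first component outside the domain;
    - [C^* C = diag(0, A ^ 2)], so [|C| = diag(0, A)]. Hence [|C| C = 0] and
      [C |C| (x1, x2) = (A ^ 2 x2, 0)], so that [|C| B - B |C|] is minus the
      latter. It is unbounded; and since the domain of [A ^ 2] is contained in
      that of [A], its domain is the maximal one and it is closed.

    Everything happens in the single space [l2] of square-summable complex
    sequences, by interleaving the two copies: the coordinates [2k] and [2k+1]
    hold the entries of [x1] and [x2]. The operators are then weighted
    compositions [x |-> (w_i x_(p i))_i] on their maximal domains ([wop]), which
    are always closed ([wop_closed]); [wop_unbounded] and [wop_dense] give the
    other basic properties, and [wop_adjoint] the adjoint.

    The remaining point is that [|C|] is unique ([diag_sqrt_unique]). This does
    not need spectral theory: [C^* C] has an orthonormal basis of eigenvectors,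
    and a positive square root must act on an eigenvector of [C^* C] by the
    square root of its eigenvalue ([positive_sqrt_eigenvector]).

    In the space [l2] the inner product is the sum of an absolutely convergent
    series, the triangle inequality comes from Cauchy-Schwarz
    ([dot_triangle]), and completeness is [l2_complete]. *)

(** * Cauchy-Schwarz and the triangle inequality for a positive definite form *)

Section DotNorm.
Context {K : numClosedFieldType} {U : lmodType K} (dot : {dot U for Num.conj}).

(** The square of the norm of the component of [u] orthogonal to [v] is
    nonnegative; expanding it gives the inequality. *)
Lemma dot_CauchySchwarz (u v : U) :
  `|dot u v| ^+ 2 <= dot u u * dot v v.
Proof.
have [->|v0] := eqVneq v 0; first by rewrite !linear0r normr0 expr0n.
have vv0 : 0 < dot v v by exact: neq0_dnorm_gt0.
have := dnorm_ge0 dot (u - (dot u v / dot v v) *: v).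
rewrite dnormB dnormZ (linearZr_LR dot u) /=.
have -> : dot u u + `|dot u v / dot v v| ^+ 2 * dot v v
    - ((dot u v / dot v v)^* * dot u v + ((dot u v / dot v v)^* * dot u v)^*)
    = dot u u - `|dot u v| ^+ 2 / dot v v.
  have vvV : ((dot v v)^-1)^* = (dot v v)^-1.
    by apply/CrealP; rewrite realV gtr0_real.
  rewrite !normCK !(rmorphM Num.conj) /= !vvV !conjCK.
  by field; rewrite gt_eqF.
by rewrite subr_ge0 ler_pdivrMr.
Qed.

Lemma dot_triangle (u v : U) :
  sqrtC (dot (u + v) (u + v)) <= sqrtC (dot u u) + sqrtC (dot v v).
Proof.
rewrite -ler_sqr ?nnegrE ?addr_ge0 ?sqrt_dnorm_ge0//.
rewrite sqrrD !sqrtCK dnormD [leRHS]addrAC lerD2l.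
rewrite -[_ + _](divfK (negbT (pnatr_eq0 K 2))) -[leRHS]mulr_natr.
rewrite ler_pM2r ?ltr0n//.
rewrite -ReE; apply: le_trans (_ : `|dot u v| <= _).
  by exact: (leif_Re_Creal _).1.
rewrite -ler_sqr ?nnegrE ?mulr_ge0 ?sqrt_dnorm_ge0//.
by rewrite exprMn !sqrtCK dot_CauchySchwarz.
Qed.
End DotNorm.

Local Open Scope complex_scope.

(** * Sums of complex series *)

Section ComplexSeries.
Context {R : realType}.
Implicit Types u v : nat -> R[i].

Definition csummable u :=
  cvgn (series (fun i => complex.Re (u i))) /\
  cvgn (series (fun i => complex.Im (u i))).

(** Limits are taken in the real and imaginary parts separately, which reduces
    every statement to real series. *)
Definition csum u : R[i] :=
  limn (series (fun i => complex.Re (u i))) +i*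
  limn (series (fun i => complex.Im (u i))).

Lemma series0 : series (fun=> 0 : R) = (fun=> 0).
Proof. by apply/funext => n; rewrite /series /= big1. Qed.

Lemma lin_series (f g h : nat -> R) (a b : R) :
  cvgn (series f) -> cvgn (series g) -> cvgn (series h) ->
  series (fun i => a * f i + b * g i + h i) @ \oo -->
    a * limn (series f) + b * limn (series g) + limn (series h).
Proof.
move=> cf cg ch.
have -> : series (fun i => a * f i + b * g i + h i) =
    (fun n => a * series f n + b * series g n + series h n).
  by apply/funext => n; rewrite /series /= !mulr_sumr -!big_split.
by apply: cvgD => //; apply: cvgD; apply: cvgMr.
Qed.

Lemma csum_lin (a : R[i]) u v : csummable u -> csummable v ->
  csum (fun i => a * u i + v i) = a * csum u + csum v.
Proof.
move=> [ur ui] [vr vi]; rewrite /csum.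
rewrite (_ : (fun _ => complex.Re _) = fun i =>
    complex.Re a * complex.Re (u i) + (- complex.Im a) * complex.Im (u i)
    + complex.Re (v i)); last first.
  by apply/funext => i; case: a (u i) (v i) => [? ?] [? ?] [? ?] /=; ring.
rewrite (_ : (fun _ => complex.Im _) = fun i =>
    complex.Re a * complex.Im (u i) + complex.Im a * complex.Re (u i)
    + complex.Im (v i)); last first.
  by apply/funext => i; case: a (u i) (v i) => [? ?] [? ?] [? ?] /=; ring.
rewrite (cvg_lim _ (lin_series ur ui vr))//.
rewrite (cvg_lim _ (lin_series ui ur vi))//.
case: a => a b; apply/eqP; rewrite eq_complex /=.
by apply/andP; split; apply/eqP; ring.
Qed.

Lemma csum_conj u : csummable u ->
  csum (fun i => (u i)^*%C) = (csum u)^*%C.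
Proof.
move=> [ur ui]; rewrite /csum /=.
rewrite (_ : (fun i => complex.Re (u i)^*%C) =
    fun i => complex.Re (u i)); last first.
  by apply/funext => i; case: (u i).
rewrite (_ : (fun i => complex.Im (u i)^*%C) = - (fun i => complex.Im (u i)));
    last first.
  by apply/funext => i /=; rewrite fctE; case: (u i).
by rewrite lim_seriesN.
Qed.

Lemma series_shift (f : nat -> R) : f 0 = 0 ->
  series (fun i => f i.+1) = (fun n => series f n.+1).
Proof.
by move=> f0; apply/funext => n; rewrite /series /= big_nat_recl//= f0 add0r.
Qed.

Lemma limn_shiftS (f : nat -> R) : limn (fun n => f n.+1) = limn f.
Proof.
by rewrite /lim; congr (xget _ _); apply/funext => l; rewrite /= (cvg_shiftS f).
Qed.

Lemma csum_shift u : u 0 = 0 -> csum (fun i => u i.+1) = csum u.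
Proof.
move=> u0; rewrite /csum.
rewrite (series_shift (f := fun i => complex.Re (u i))) ?u0//.
rewrite (series_shift (f := fun i => complex.Im (u i))) ?u0//.
by congr (_ +i* _); apply: limn_shiftS.
Qed.
End ComplexSeries.

(** * The Hilbert space of square-summable sequences *)

Section SquareSummable.
Context {R : realType}.
Implicit Types (x y : nat -> R[i]) (z w : R[i]).

(** The squared modulus as a real number: the norm of [R[i]] takes its values
    in [R[i]], where the order is only partial. *)
Definition sqmod z : R := complex.Re z ^+ 2 + complex.Im z ^+ 2.

Lemma conj_real_complex (r : R) : ((r%:C)^*)%R = r%:C :> R[i].
Proof. by apply/CrealP/complex_realP; exists r. Qed.

Lemma sqmod_ge0 z : 0 <= sqmod z.
Proof. by rewrite addr_ge0 ?sqr_ge0. Qed.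

Lemma sqmodD z w : sqmod (z + w) <= 2 * sqmod z + 2 * sqmod w.
Proof.
rewrite -subr_ge0; have := sqmod_ge0 (z - w).
by case: z w => [a b] [c d]; rewrite /sqmod /=; lra.
Qed.

Lemma sqmodM z w : sqmod (z * w) = sqmod z * sqmod w.
Proof. by case: z w => [a b] [c d]; rewrite /sqmod /=; ring. Qed.

Lemma sqmod_eq0 z : sqmod z = 0 -> z = 0.
Proof.
case: z => a b /eqP; rewrite /sqmod /= paddr_eq0 ?sqr_ge0// !sqrf_eq0.
by move=> /andP[/eqP-> /eqP->].
Qed.

Definition square_summable x := cvgn (series (fun i => sqmod (x i))).

Lemma series_sqmod_nondec x : nondecreasing_seq (series (fun i => sqmod (x i))).
Proof. by apply: nondecreasing_series => *; exact: sqmod_ge0. Qed.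

Lemma square_summable_bounded x (M : R) :
  (forall n, series (fun i => sqmod (x i)) n <= M) -> square_summable x.
Proof.
move=> xM; apply: nondecreasing_is_cvgn; first exact: series_sqmod_nondec.
by exists M => _ [n _ <-].
Qed.

Lemma square_summable_le x y : (forall i, sqmod (x i) <= sqmod (y i)) ->
  square_summable y -> square_summable x.
Proof. by move=> xy; apply: series_le_cvg => // n; exact: sqmod_ge0. Qed.

Lemma square_summable_lin (a : R[i]) x y :
  square_summable x -> square_summable y ->
  square_summable (fun i => a * x i + y i).
Proof.
move=> sx sy.
have : cvgn (series (fun i => (2 * sqmod a) * sqmod (x i) + 2 * sqmod (y i) + 0)).
  apply: cvgP; apply: lin_series => //.
  by rewrite series0; exact: is_cvg_cst.
apply: series_le_cvg => n; first exact: sqmod_ge0.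
  by rewrite !addr_ge0 ?mulr_ge0 ?sqmod_ge0.
by rewrite addr0 (le_trans (sqmodD _ _))// sqmodM mulrA.
Qed.

Lemma square_summable_shift x :
  square_summable (fun i => x i.+1) -> square_summable x.
Proof.
move=> sx.
have [M hM] : exists M, forall n, series (fun i => sqmod (x i.+1)) n <= M.
  exists (limn (series (fun i => sqmod (x i.+1)))) => n.
  apply: nondecreasing_cvgn_le => //.
  exact: (@series_sqmod_nondec (fun i => x i.+1)).
apply: (@square_summable_bounded _ (sqmod (x 0%N) + M)) => -[|n].
  rewrite /series /= big_geq// addr_ge0 ?sqmod_ge0// (le_trans _ (hM 0%N))//.
  by rewrite /series /= big_geq.
by rewrite /series /= big_nat_recl// lerD2l; exact: hM.
Qed.

Lemma square_summable_unshift x :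
  square_summable x -> square_summable (fun i => x i.+1).
Proof.
move=> sx.
apply: (@square_summable_bounded _ (limn (series (fun i => sqmod (x i))))).
move=> n; apply: le_trans (nondecreasing_cvgn_le (@series_sqmod_nondec x) sx n.+1).
by rewrite /series /= big_nat_recl// lerDr sqmod_ge0.
Qed.

(** Instances of [|z w^*| <= |z|^2 + |w|^2]: they make the inner product of two
    square-summable sequences an absolutely convergent series. *)
Lemma ReM_conj_le z w : `|complex.Re (z * w^*)| <= sqmod z + sqmod w.
Proof.
have := sqmod_ge0 (z + w); have := sqmod_ge0 (z - w).
have := sqmod_ge0 z; have := sqmod_ge0 w.
case: z w => [a b] [c d]; rewrite /sqmod /= => *.
by rewrite ler_norml; apply/andP; split; lra.
Qed.

Lemma ImM_conj_le z w : `|complex.Im (z * w^*)| <= sqmod z + sqmod w.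
Proof.
have := sqmod_ge0 (z + 'i * w); have := sqmod_ge0 (z - 'i * w).
have := sqmod_ge0 z; have := sqmod_ge0 w.
case: z w => [a b] [c d]; rewrite /sqmod /= => *.
by rewrite ler_norml; apply/andP; split; lra.
Qed.

Lemma csummable_mul_conj x y : square_summable x -> square_summable y ->
  csummable (fun i => x i * (y i)^*).
Proof.
move=> sx sy.
have sxy : cvgn (series (fun i => sqmod (x i) + sqmod (y i))).
  exact: is_cvg_seriesD sx sy.
split; apply: normed_cvg; apply: series_le_cvg sxy => n /=.
- by [].
- by rewrite addr_ge0 ?sqmod_ge0.
- exact: ReM_conj_le.
- by [].
- by rewrite addr_ge0 ?sqmod_ge0.
- exact: ImM_conj_le.
Qed.

Definition l2_pred : {pred nat -> R[i]} := fun x => `[< square_summable x >].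

Lemma l2_predP x : reflect (square_summable x) (x \in l2_pred).
Proof. exact: asboolP. Qed.

Lemma l2_submod_closed : submod_closed l2_pred.
Proof.
split=> [|a x y /l2_predP sx /l2_predP sy]; apply/l2_predP.
  apply: (@square_summable_bounded _ 0) => n.
  by rewrite /series /= big1// => i _; rewrite /sqmod /= expr0n addr0.
exact: square_summable_lin.
Qed.

HB.instance Definition _ := GRing.isSubmodClosed.Build _ _ l2_pred l2_submod_closed.

End SquareSummable.

Record l2 (R : realType) :=
  L2 { l2val :> nat -> R[i]; l2_subproof : l2val \in l2_pred }.

Section L2.
Context {R : realType}.

HB.instance Definition _ := [isSub for @l2val R].
HB.instance Definition _ := [Choice of l2 R by <:].
HB.instance Definition _ := [SubChoice_isSubLmodule of l2 R by <:].

Implicit Types x y : l2 R.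

Lemma l2P x : square_summable x.
Proof. exact/l2_predP/l2_subproof. Qed.

Lemma l2_ext x y : (forall i, x i = y i) -> x = y.
Proof. by move=> xy; apply/val_inj/funext. Qed.

Lemma l2_0 i : (0 : l2 R) i = 0. Proof. by []. Qed.
Lemma l2D x y i : (x + y) i = x i + y i. Proof. by []. Qed.
Lemma l2B x y i : (x - y) i = x i - y i. Proof. by []. Qed.
Lemma l2Z (a : R[i]) x i : (a *: x) i = a * x i. Proof. by []. Qed.

Definition l2dot x y : R[i] := csum (fun i => x i * (y i)^*).

Lemma l2dot_lin (a : R[i]) x y w : l2dot (a *: x + y) w = a * l2dot x w + l2dot y w.
Proof.
rewrite /l2dot -csum_lin; [|by apply: csummable_mul_conj; exact: l2P..].
by congr csum; apply/funext => i; rewrite l2D l2Z mulrDl mulrA.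
Qed.

Lemma l2dot_conj x y : l2dot x y = (l2dot y x)^*.
Proof.
rewrite /l2dot -csum_conj; last by apply: csummable_mul_conj; exact: l2P.
by congr csum; apply/funext => i; rewrite (rmorphM (@conjc R)) /= conjcK mulrC.
Qed.

Lemma l2dot_bilinear :
  bilinear_for ( *%R : GRing.Scale.law R[i] _)
    (Num.conj \; *%R : GRing.Scale.law R[i] _) l2dot.
Proof.
split=> [w a x y|w a x y]; first exact: l2dot_lin.
rewrite l2dot_conj l2dot_lin (l2dot_conj w x) (l2dot_conj w y).
by rewrite (rmorphD (@conjc R)) (rmorphM (@conjc R)).
Qed.

HB.instance Definition _ := bilinear_isBilinear.Build R[i] (l2 R) (l2 R) R[i]
  ( *%R ) (Num.conj \; *%R) l2dot l2dot_bilinear.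

Lemma l2dot_hermitian x y : l2dot x y = (-1) ^+ false * Num.conj (l2dot y x).
Proof. by rewrite mul1r l2dot_conj. Qed.

HB.instance Definition _ :=
  isHermitianSesquilinear.Build R[i] (l2 R) false Num.conj l2dot l2dot_hermitian.

Definition normsq x : R := limn (series (fun i => sqmod (x i))).

Lemma l2dot_normsq x : l2dot x x = (normsq x)%:C.
Proof.
rewrite /l2dot /csum /normsq; congr (_ +i* _).
  congr (limn (series _)); apply/funext => i.
  by rewrite /sqmod; case: (x i) => a b /=; ring.
rewrite (_ : (fun _ => _) = fun=> 0) ?series0 ?lim_cst//.
by apply/funext => i; case: (x i) => a b /=; ring.
Qed.

Lemma series_le_normsq x n : series (fun i => sqmod (x i)) n <= normsq x.
Proof.
by apply: nondecreasing_cvgn_le; [exact: series_sqmod_nondec|exact: l2P].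
Qed.

Lemma normsq_le x (M : R) :
  (forall n, series (fun i => sqmod (x i)) n <= M) -> normsq x <= M.
Proof. by move=> xM; apply: limr_le; [exact: l2P|exact: nearW]. Qed.

Lemma normsq_ge0 x : 0 <= normsq x.
Proof. by apply: le_trans (series_le_normsq x 0); rewrite /series /= big_geq. Qed.

Lemma sqmod_le_normsq x i : sqmod (x i) <= normsq x.
Proof.
apply: le_trans (series_le_normsq x i.+1).
by rewrite /series /= big_nat_recr//= lerDr sumr_ge0// => *; exact: sqmod_ge0.
Qed.

Lemma l2dot_gt0 x : x != 0 -> 0 < l2dot x x.
Proof.
move=> x0; rewrite l2dot_normsq ltcR lt_def normsq_ge0 andbT.
apply: contra x0 => /eqP nx0; apply/eqP/l2_ext => i; apply/sqmod_eq0/eqP.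
by rewrite eq_le sqmod_ge0 andbT -nx0 sqmod_le_normsq.
Qed.

HB.instance Definition _ := isDotProduct.Build R[i] (l2 R) l2dot l2dot_gt0.

Definition l2norm x : R[i] := sqrtC (l2dot x x).

Lemma l2norm_triangle x y : l2norm (x + y) <= l2norm x + l2norm y.
Proof. exact: (dot_triangle l2dot). Qed.

Lemma l2normZ (a : R[i]) x : l2norm (a *: x) = `|a| * l2norm x.
Proof.
by rewrite /l2norm (dnormZ l2dot) sqrtCM ?nnegrE ?exprn_ge0 ?(dnorm_ge0 l2dot)// sqrCK.
Qed.

Lemma l2norm_eq0 x : l2norm x = 0 -> x = 0.
Proof. by move=> /eqP; rewrite (sqrt_dnorm_eq0 l2dot) => /eqP. Qed.

HB.instance Definition _ :=
  Lmodule_isNormed.Build R[i] (l2 R) l2norm_triangle l2normZ l2norm_eq0.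

Lemma l2_normE x : `|x| = (Num.sqrt (normsq x))%:C.
Proof.
rewrite -[LHS]/(sqrtC (l2dot x x)) l2dot_normsq -{1}[normsq x]sqr_sqrtr ?normsq_ge0//.
by rewrite rmorphXn /= sqrCK// ler0c sqrtr_ge0.
Qed.

Lemma l2_norm_lt x (e : R) : 0 < e -> (`|x| < e%:C) = (normsq x < e ^+ 2).
Proof.
move=> e0; rewrite l2_normE ltcR -[X in _ < X]ger0_norm ?ltW// -sqrtr_sqr.
by rewrite ltr_sqrt// exprn_gt0.
Qed.

Lemma l2_norm_le x (e : R) : 0 <= e -> normsq x <= e ^+ 2 -> `|x| <= e%:C.
Proof.
move=> e0 xe; rewrite l2_normE lecR -[X in _ <= X]ger0_norm// -sqrtr_sqr.
exact: ler_wsqrtr.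
Qed.

Lemma ball_l2E x y (e : R) : 0 < e -> ball x e%:C y <-> normsq (x - y) < e ^+ 2.
Proof. by move=> e0; rewrite -ball_normE /ball_ /= l2_norm_lt. Qed.

Lemma gt0_real_complex (e : R[i]) : 0 < e -> exists2 r : R, 0 < r & e = r%:C.
Proof.
by case: e => a b; rewrite ltcE /= => /andP[/eqP-> a0]; exists a.
Qed.

Lemma Re_coord_le x y i :
  `|complex.Re (x i) - complex.Re (y i)|%:C <= `|x - y|.
Proof.
rewrite l2_normE lecR -sqrtr_sqr ler_wsqrtr//.
apply: le_trans (sqmod_le_normsq _ i).
by rewrite l2B /sqmod; case: (x i) (y i) => [? ?] [? ?] /=; rewrite lerDl sqr_ge0.
Qed.

Lemma Im_coord_le x y i :
  `|complex.Im (x i) - complex.Im (y i)|%:C <= `|x - y|.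
Proof.
rewrite l2_normE lecR -sqrtr_sqr ler_wsqrtr//.
apply: le_trans (sqmod_le_normsq _ i).
by rewrite l2B /sqmod; case: (x i) (y i) => [? ?] [? ?] /=; rewrite lerDr sqr_ge0.
Qed.

(** The coordinates of a Cauchy filter converge. A finite sum of squared
    distances passes to the limit along the filter, so the bounds on the partial
    sums survive, uniformly in their length; hence the coordinatewise limit is
    square-summable and is the limit in norm. *)
Lemma l2_complete (F : set_system (l2 R)) : ProperFilter F -> cauchy F -> cvg F.
Proof.
move=> FF /cauchyP Fc.
have Fsq (e : R) : 0 < e -> exists x, F [set y | normsq (x - y) < e ^+ 2].
  move=> e0; have [|x Fx] := Fc e%:C; first by rewrite ltcR.
  by exists x; apply: filterS Fx => y /ball_l2E; exact.
have cvgF (f : l2 R -> R) :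
    (forall x y, `|f x - f y|%:C <= `|x - y|) -> cvg (f @ F).
  move=> fle; apply: R_complete; apply/cauchyP => e e0.
  have [x Fx] := Fsq e e0; exists (f x).
  suff : F [set y | ball (f x) e (f y)] by [].
  apply: filterS Fx => y /=; rewrite -l2_norm_lt// => xy.
  by rewrite /ball /= -ltcR (le_lt_trans (fle _ _)).
have cRe i : cvg ((fun x : l2 R => complex.Re (x i)) @ F).
  by apply: cvgF => x y; exact: Re_coord_le.
have cIm i : cvg ((fun x : l2 R => complex.Im (x i)) @ F).
  by apply: cvgF => x y; exact: Im_coord_le.
pose a i := lim ((fun x : l2 R => complex.Re (x i)) @ F) +i*
            lim ((fun x : l2 R => complex.Im (x i)) @ F).
have cvg_dist (x : l2 R) n :
    (fun y : l2 R => series (fun i => sqmod (x i - y i)) n) @ F -->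
    series (fun i => sqmod (x i - a i)) n.
  rewrite /series /=; apply: (cvg_big (op := +%R)) => [z|i _]; first exact: add_continuous.
  rewrite (_ : (fun y : l2 R => _) = fun y : l2 R =>
     (complex.Re (x i) - complex.Re (y i)) ^+ 2 +
     (complex.Im (x i) - complex.Im (y i)) ^+ 2); last first.
    by apply/funext => y; rewrite /sqmod; case: (x i) (y i) => [? ?] [? ?].
  rewrite (_ : sqmod _ = (complex.Re (x i) - complex.Re (a i)) ^+ 2 +
     (complex.Im (x i) - complex.Im (a i)) ^+ 2); last first.
    by rewrite /sqmod; case: (x i) (a i) => [? ?] [? ?].
  by apply: cvgD; apply: cvgM; apply: cvgB; (exact: cvg_cst || exact: cRe || exact: cIm).
have dist_le (x : l2 R) (e : R) : F [set y | normsq (x - y) < e] ->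
    forall n, series (fun i => sqmod (x i - a i)) n <= e.
  move=> Fx n; rewrite -(cvg_lim _ (cvg_dist x n))//.
  apply: limr_le; first exact: cvgP (cvg_dist x n).
  apply: filterS Fx => y /ltW; apply: le_trans.
  exact: (series_le_normsq (x - y)).
have [x1 Fx1] := Fsq 1 ltr01.
(* a is x1 minus a square-summable sequence. *)
have a_l2 : a \in l2_pred.
  have xa : (fun i => x1 i - a i) \in l2_pred.
    by apply/l2_predP; exact: square_summable_bounded (dist_le _ _ Fx1).
  rewrite (_ : a = (x1 : nat -> R[i]) - (fun i => x1 i - a i)); last first.
    by apply/funext => i /=; rewrite !fctE subKr.
  by rewrite rpredB//; exact: l2_subproof.
apply/cvg_ex; exists (L2 a_l2); apply/fcvgrPdist_lt => eps /gt0_real_complex[e e0 ->].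
have e20 : 0 < e / 2 by rewrite divr_gt0.
have [x Fx] := Fsq _ e20; apply: filterS (Fx) => y xy /=.
rewrite -(subrK x (L2 a_l2)) -addrA (le_lt_trans (ler_normD _ _))//.
rewrite [X in (X)%:C]splitr rmorphD ler_ltD//; last by rewrite l2_norm_lt.
rewrite distrC; apply: l2_norm_le; first exact: ltW.
apply: normsq_le => n.
exact: (dist_le _ _ Fx).
Qed.

HB.instance Definition _ := Uniform_isComplete.Build (l2 R) l2_complete.

Lemma l2_hdotE (x : l2 R) : `|x| ^+ 2 = l2dot x x.
Proof. exact: sqrtCK. Qed.

HB.instance Definition _ :=
  CompleteNormedModule_isHilbert.Build R (l2 R) l2_hdotE.

End L2.

(** * Operators on an abstract Hilbert space *)

Section OperatorEquality.
Context {R : realType} {H : hilbertType R}.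
Implicit Types S T : operator H.

Lemma opeq_sym S T : opeq S T -> opeq T S.
Proof. by move=> [dST ST]; split=> [|x]; rewrite -?dST// => Sx; rewrite ST. Qed.

Lemma opeq_trans S T U : opeq S T -> opeq T U -> @opeq R H S U.
Proof.
move=> [dST ST] [dTU TU]; split; first by rewrite dST.
by move=> x Sx; rewrite ST// TU// -dST.
Qed.

Lemma opeq_graph S T : opeq S T -> graph S = graph T.
Proof.
move=> [dST ST]; apply/seteqP; split=> -[x y] [/= Dx ->].
  by split=> /=; rewrite -?dST// ST.
by split=> /=; rewrite ?dST// ST// dST.
Qed.

Lemma opeq_closed S T : opeq S T -> closed_operator T -> closed_operator S.
Proof. by move=> /opeq_graph ST; rewrite /closed_operator ST. Qed.

Lemma opeq_bounded S T : opeq S T -> bounded_operator S -> bounded_operator T.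
Proof.
move=> [dST ST] [M [M0 SM]]; exists M; split=> // x.
by rewrite -dST => Sx; rewrite -ST// SM.
Qed.

(** The domain of [T] is the slice of its graph at height [0]. *)
Lemma closed_zero_operator_dom T :
  (forall x, opdom T x -> T x = 0) -> closed_operator T -> closed (opdom T).
Proof.
move=> T0 Tcl; rewrite (_ : opdom T = (fun x : H => (x, 0 : H)) @^-1` graph T).
  apply: preimage_closed Tcl => x _.
  by apply: cvg_pair; [exact: cvg_id|exact: cvg_cst].
by apply/seteqP; split => x /= => [Tx|[]//]; split => //=; rewrite T0.
Qed.

(** With [f = T e - l e] one has [(T + l) f = (T ^ 2 - l ^ 2) e = 0], so
    [T f = - l f]; for [l > 0] positivity of [T] forces [f = 0]. For [l = 0],
    [|T e| ^ 2 = (e, T (T e)) = 0]. *)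
Lemma positive_sqrt_eigenvector T (e : H) (l : R) :
  self_adjoint T -> positive_operator T -> 0 <= l ->
  opdom (opmul T T) e -> T (T e) = (l ^+ 2)%:C *: e -> T e = l%:C *: e.
Proof.
move=> [_ [_ Tsym]] Tpos l0 [De DTe] TTe.
pose f := (- l%:C) *: e + T e.
have Df : opdom T f by exact: opdomP.
have Tf : T f = (- l%:C) *: f.
  by rewrite opfunP// TTe scalerDr scalerA mulrNN -rmorphM -expr2 addrC.
suff f0 : f = 0 by apply/eqP; rewrite -subr_eq0 -scaleNr addrC -/f f0.
have [l_eq0|ln0] := eqVneq l 0.
  apply/eqP; rewrite -(dnorm_eq0 hdot) /f l_eq0 oppr0 scale0r add0r Tsym//.
  by rewrite TTe l_eq0 expr0n scale0r linear0r.
have := Tpos f Df; rewrite Tf (linearZl_LR hdot) /= mulNr oppr_ge0 pmulr_rle0; last first.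
  by rewrite ltcR lt_def ln0.
move=> ff; apply/eqP; rewrite -(dnorm_eq0 hdot).
by rewrite eq_le ff dnorm_ge0.
Qed.

End OperatorEquality.

(** * Coordinates, truncations and the standard basis *)

Section L2Topology.
Context {R : realType}.
Implicit Types x y : l2 R.

Lemma continuous_nonexpansive (V : normedModType R[i]) (f : V -> R) :
  (forall u v, `|f u - f v|%:C <= `|u - v|) -> continuous f.
Proof.
move=> fle u; apply/cvgrPdist_lt => e e0.
apply/nbhs_ballP; exists e%:C => [|v]; first by rewrite /= ltcR.
by rewrite -ball_normE /= => uv; rewrite -ltcR (le_lt_trans (fle _ _)).
Qed.

(** The graphs below are intersections of such sets, which is how they are shown
    to be closed. *)
Lemma closed_coord_relation (i j : nat) (c : R) :
  closed [set q : l2 R * l2 R | q.2 i = c%:C * q.1 j].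
Proof.
have cont_comb (f : l2 R -> R) (g : l2 R -> R) : continuous f -> continuous g ->
    closed [set q : l2 R * l2 R | f q.2 - c * g q.1 = 0].
  move=> cf cg.
  apply: (@preimage_closed _ _ (fun q : l2 R * l2 R => f q.2 - c * g q.1) [set 0]).
    move=> q _; apply: cvgB.
      by apply: (@cvg_comp _ _ _ snd f); [exact: cvg_snd|exact: cf].
    apply: cvgMr; apply: (@cvg_comp _ _ _ fst g); [exact: cvg_fst|exact: cg].
  exact: closed_eq.
rewrite (_ : [set _ | _] =
  [set q : l2 R * l2 R | complex.Re (q.2 i) - c * complex.Re (q.1 j) = 0] `&`
  [set q : l2 R * l2 R | complex.Im (q.2 i) - c * complex.Im (q.1 j) = 0]).
  apply: closedI.
    apply: (cont_comb (fun x => complex.Re (x i)) (fun x => complex.Re (x j)));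
      by apply: continuous_nonexpansive => x y; exact: Re_coord_le.
  apply: (cont_comb (fun x => complex.Im (x i)) (fun x => complex.Im (x j)));
    by apply: continuous_nonexpansive => x y; exact: Im_coord_le.
apply/seteqP; split => q /=; case: (q.2 i) (q.1 j) => [a b] [a' b'] /=.
  by move=> [-> ->]; split; ring.
move=> [/eqP + /eqP]; rewrite !subr_eq0 => /eqP-> /eqP->.
apply/eqP; rewrite eq_complex /=.
by apply/andP; split; apply/eqP; ring.
Qed.

Lemma square_summable_finite (u : nat -> R[i]) (n : nat) :
  (forall i, (n <= i)%N -> u i = 0) -> square_summable u.
Proof.
elim: n u => [|n IHn] u u0; last first.
  by apply: square_summable_shift; apply: IHn => i ni; exact: u0.
apply: (@square_summable_bounded _ _ 0) => n.
by rewrite /series /= big1// => i _; rewrite u0// /sqmod /= expr0n addr0.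
Qed.

Fact trunc_subproof x n : (fun i => if (i < n)%N then x i else 0) \in l2_pred.
Proof.
apply/l2_predP; apply: (@square_summable_finite _ n) => i.
by rewrite leqNgt => /negbTE->.
Qed.

Definition trunc x n : l2 R := L2 (trunc_subproof x n).

Lemma normsq_sub_trunc x n :
  normsq (x - trunc x n) <= normsq x - series (fun i => sqmod (x i)) n.
Proof.
apply: normsq_le => m; rewrite lerBrDr.
apply: le_trans (series_le_normsq x (maxn m n)).
elim: m => [|m IHm]; first by rewrite max0n [series _ 0%N]/series /= big_geq// add0r.
have tailE : sqmod ((x - trunc x n) m) = if (m < n)%N then 0 else sqmod (x m).
  by rewrite l2B /=; case: ifP; rewrite (subr0, subrr)// /sqmod /= expr0n addr0.
rewrite seriesSr tailE; have [mn|nm] := ltnP m n.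
  by move: IHm; rewrite addr0 (maxn_idPr (ltnW mn)) (maxn_idPr mn).
rewrite (maxn_idPl (leqW nm)) seriesSr addrAC lerD2r.
by move: IHm; rewrite (maxn_idPl nm).
Qed.

(** Truncations converge: the squared error is the tail of a convergent series. *)
Lemma dense_finite_support (D : set (l2 R)) :
  (forall x n, (forall i, (n <= i)%N -> x i = 0) -> D x) -> dense D.
Proof.
move=> finD O [x Ox] Oo.
have /nbhs_ballP[_/posnumP[eps] xO] : nbhs x O by exact: open_nbhs_nbhs.
have [e e0 epsE] := gt0_real_complex (gt0 eps).
have /cvgrPdist_lt/(_ (e ^+ 2)) [|n _ /(_ n (leqnn n))] := @l2P R x.
  by rewrite exprn_gt0.
rewrite /= ger0_norm ?subr_ge0 ?series_le_normsq// => xn.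
exists (trunc x n); split; last first.
  by apply: (finD _ n) => i /=; rewrite leqNgt => /negbTE->.
apply: xO; rewrite /= epsE; apply/ball_l2E => //.
exact: le_lt_trans (normsq_sub_trunc _ _) xn.
Qed.

Fact delta_subproof j : (fun i => if i == j then 1 else 0) \in @l2_pred R.
Proof.
apply/l2_predP; apply: (@square_summable_finite _ j.+1) => i ji.
by rewrite gtn_eqF.
Qed.

Definition delta j : l2 R := L2 (delta_subproof j).

Lemma deltaE j i : delta j i = if i == j then 1 else 0.
Proof. by []. Qed.

Lemma delta_finite j i : (j.+1 <= i)%N -> delta j i = 0.
Proof. by move=> ji /=; rewrite gtn_eqF. Qed.

Lemma csum_single (u : nat -> R[i]) j : (forall i, i != j -> u i = 0) -> csum u = u j.
Proof.
move=> uj.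
have lim_single (f : nat -> R) : (forall i, i != j -> f i = 0) -> limn (series f) = f j.
  move=> fj; apply: cvg_lim => //; apply: cvg_near_cst.
  exists j.+1 => // n /= jn.
  rewrite /series /= (bigD1_seq j) ?mem_index_iota ?iota_uniq//=.
  by rewrite big1 ?addr0.
by rewrite /csum !lim_single; [case: (u j)|move=> i ij; rewrite uj..].
Qed.

Lemma l2dot_delta_r x j : l2dot x (delta j) = x j.
Proof.
rewrite /l2dot (csum_single (j := j)) => [|i /negbTE ij].
  by rewrite deltaE eqxx conjC1 mulr1.
by rewrite deltaE ij conjC0 mulr0.
Qed.

Lemma l2dot_delta_l x j : l2dot (delta j) x = (x j)^*.
Proof. by rewrite l2dot_conj l2dot_delta_r. Qed.

Lemma norm_delta j : `|delta j| = 1.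
Proof. by apply/eqP; rewrite -sqrp_eq1// l2_hdotE l2dot_delta_r /= eqxx. Qed.

End L2Topology.

(** * Weighted composition operators *)

Section WeightedComposition.
Context {R : realType}.
Implicit Types (w v : nat -> R) (p q : nat -> nat) (x y : l2 R).

Definition wseq w p (x : nat -> R[i]) : nat -> R[i] := fun i => (w i)%:C * x (p i).

Definition wdom w p : set (l2 R) := [set x | square_summable (wseq w p x)].

Definition wfun w p x : l2 R := insubd (0 : l2 R) (wseq w p x).

Lemma wfunE w p x i : wdom w p x -> wfun w p x i = (w i)%:C * x (p i).
Proof.
move=> wx; rewrite /wfun [LHS](congr1 (@^~ i) (insubdK _ _))//.
exact/l2_predP.
Qed.

Lemma wseq_lin w p (a : R[i]) x y :
  wseq w p (a *: x + y) = (fun i => a * wseq w p x i + wseq w p y i).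
Proof. by apply/funext => i; rewrite /wseq l2D l2Z mulrDr mulrCA. Qed.

Lemma wdom0 w p : wdom w p 0.
Proof.
by apply: (@square_summable_finite _ _ 0) => i _; rewrite /wseq l2_0 mulr0.
Qed.

Lemma wdomP w p (a : R[i]) x y :
  wdom w p x -> wdom w p y -> wdom w p (a *: x + y).
Proof. by rewrite /wdom /= wseq_lin; exact: square_summable_lin. Qed.

Lemma wfunP w p (a : R[i]) x y : wdom w p x -> wdom w p y ->
  wfun w p (a *: x + y) = a *: wfun w p x + wfun w p y.
Proof.
move=> wx wy; apply: l2_ext => i; rewrite wfunE; last exact: wdomP.
by rewrite !l2D !l2Z !wfunE// mulrDr mulrCA.
Qed.

(** The weighted composition operator [x |-> (w_i x_(p i))_i] with its maximal
    domain. Diagonal operators and weighted shifts in both directions are of this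
    form, and so are, up to their domains, the products of such operators. *)
Definition wop w p : operator (l2 R) :=
  Operator (@wdom0 w p) (@wdomP w p) (@wfunP w p).

Lemma wopE w p x i : opdom (wop w p) x -> wop w p x i = (w i)%:C * x (p i).
Proof. exact: wfunE. Qed.

Lemma wop_graphE w p :
  graph (wop w p) = [set q : l2 R * l2 R | forall i, q.2 i = (w i)%:C * q.1 (p i)].
Proof.
apply/seteqP; split => -[x y] /=; first by move=> [/= wx ->] i; exact: wopE.
move=> /= yE; have {}yE i : y i = (w i)%:C * x (p i) by exact: yE.
have wx : wdom w p x.
  by rewrite /wdom /= (_ : wseq w p x = y); [exact: l2P|apply/funext => i; rewrite yE].
by split=> //; apply: l2_ext => i; rewrite yE wopE.
Qed.

(** Maximality of the domain makes the graph the set of all pairs that satisfy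
    the coordinate equations, each of which is a closed condition. *)
Lemma wop_closed w p : closed_operator (wop w p).
Proof.
rewrite /closed_operator wop_graphE.
rewrite (_ : [set _ | _] =
  \bigcap_i [set q : l2 R * l2 R | q.2 i = (w i)%:C * q.1 (p i)]).
  by apply: closed_bigI => i _; exact: closed_coord_relation.
by apply/seteqP; split => [q qE i _|q qE i]; [exact: qE|exact: (qE i)].
Qed.

Lemma opeq_wop (T : operator (l2 R)) w p :
  (forall x, opdom T x <-> wdom w p x) ->
  (forall x i, opdom T x -> T x i = (w i)%:C * x (p i)) ->
  opeq T (wop w p).
Proof.
move=> dT TE; split; first by apply/seteqP; split => x /dT.
by move=> x Tx; apply: l2_ext => i; rewrite TE// wopE//; exact/dT.
Qed.

Lemma opmul_wopE w p v q x i : opdom (opmul (wop w p) (wop v q)) x ->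
  opmul (wop w p) (wop v q) x i = (w i)%:C * ((v (p i))%:C * x (q (p i))).
Proof. by move=> [vx wvx] /=; rewrite wfunE// wfunE. Qed.

Lemma opmul_wop_dom w p v q x : opdom (opmul (wop w p) (wop v q)) x <->
  wdom v q x /\
  square_summable (fun i => (w i)%:C * ((v (p i))%:C * x (q (p i)))).
Proof.
have wvE : wdom v q x -> wseq w p (wop v q x) =
    (fun i => (w i)%:C * ((v (p i))%:C * x (q (p i)))).
  by move=> vx; apply/funext => i; rewrite /wseq wopE.
by split=> -[vx wvx]; split => //; move: wvx;
  rewrite -[opdom _ _]/(square_summable _) wvE.
Qed.

(** The assumption on [p] says that the coordinate [j] of [x] is only read by
    entries [i <= j + 1], so that finitely supported sequences stay finitely
    supported. *)
Section SlowIndex.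
Variables (w : nat -> R) (p : nat -> nat).
Hypothesis le_p : forall i, (i <= (p i).+1)%N.

Lemma wdom_finite_support x n : (forall i, (n <= i)%N -> x i = 0) -> wdom w p x.
Proof.
move=> x0; apply: (@square_summable_finite _ _ n.+1) => i ni.
by rewrite /wseq x0 ?mulr0// -ltnS (leq_trans ni).
Qed.

Lemma wdom_delta j : wdom w p (delta j).
Proof. by apply: (@wdom_finite_support _ j.+1) => i; exact: delta_finite. Qed.

Lemma wop_dense : densely_defined (wop w p).
Proof. by apply: dense_finite_support => x n; exact: wdom_finite_support. Qed.

Lemma wop_unbounded :
  (forall M : R, exists i, M < `|w i|) -> ~ bounded_operator (wop w p).
Proof.
move=> w_unb [M [M0 wM]]; have [i wi] := w_unb M.
have := wM (delta (p i)) (@wdom_delta (p i)).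
rewrite norm_delta mulr1 l2_normE lecR leNgt => /negP; apply.
apply: lt_le_trans wi _; rewrite -sqrtr_sqr; apply: ler_wsqrtr.
apply: le_trans (sqmod_le_normsq _ i).
rewrite wopE; last exact: wdom_delta.
by rewrite deltaE eqxx mulr1 /sqmod /= expr0n addr0.
Qed.

(** Only the action on the basis is needed to see that the adjoint is not larger
    than [wop w' p']: testing the identity that defines the adjoint on
    [delta j] computes the coordinate [j] of the candidate value. *)
Lemma wop_adjoint (w' : nat -> R) (p' : nat -> nat) :
  (forall x y, wdom w p x -> wdom w' p' y ->
     l2dot (wop w p x) y = l2dot x (wop w' p' y)) ->
  (forall j, wop w p (delta j) = (w' j)%:C *: delta (p' j)) ->
  is_adjoint (wop w p) (wop w' p').
Proof.
move=> adj wdelta; split; last exact: adj.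
move=> y; split=> [w'y|[z zE]].
  by exists (wop w' p' y) => x wx; exact: adj.
rewrite /= /wdom /= (_ : wseq w' p' y = z); first exact: l2P.
apply/funext => j; have := zE (delta j) (@wdom_delta j).
rewrite wdelta -[hdot _ _]/(l2dot _ _) -[hdot _ z]/(l2dot _ _).
rewrite (linearZl_LR l2dot) /= !l2dot_delta_l => /(congr1 Num.conj).
rewrite rmorphM /= !conjCK => <-; congr (_ * _).
exact/esym/conj_real_complex.
Qed.

End SlowIndex.

(** * Diagonal operators with nonnegative weights *)

Section Diagonal.
Variable w : nat -> R.
Hypothesis w0 : forall i, 0 <= w i.
Local Notation D := (wop w id).

Lemma diag_delta j : D (delta j) = (w j)%:C *: delta j.
Proof.
apply: l2_ext => i; rewrite wopE; last exact: wdom_delta.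
by rewrite l2Z deltaE; case: eqVneq => [->|]; rewrite // !mulr0.
Qed.

Lemma diag_symmetric x y : opdom D x -> opdom D y -> l2dot (D x) y = l2dot x (D y).
Proof.
move=> Dx Dy; congr csum; apply/funext => i; rewrite !wopE//.
by rewrite rmorphM /= conj_real_complex mulrCA mulrA.
Qed.

Lemma diag_self_adjoint : self_adjoint D.
Proof.
split; first exact: wop_dense.
apply: wop_adjoint => //; last exact: diag_delta.
exact: diag_symmetric.
Qed.

Lemma diag_positive : positive_operator D.
Proof.
move=> x Dx; rewrite -[hdot _ _]/(csum _) lecE /csum /=.
have termE i : D x i * (x i)^* = (w i * sqmod (x i))%:C.
  rewrite wopE// rmorphM -mulrA; congr (_ * _).
  by rewrite -normCK -add_Re2_Im2.
rewrite (_ : (fun i => complex.Im _) = fun=> 0); last first.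
  by apply/funext => i; rewrite termE.
rewrite series0 lim_cst// eqxx /=.
have cxD : cvgn (series (fun i => complex.Re (D x i * (x i)^*))).
  by apply: (csummable_mul_conj _ _).1; exact: l2P.
apply: limr_ge => //; apply: nearW => n; apply: sumr_ge0 => i _.
by rewrite termE /= mulr_ge0 ?sqmod_ge0.
Qed.

(** A positive square root [T] of [D ^ 2] agrees with [D] on the basis, by the
    lemma on eigenvectors. Symmetry of [T] then determines the coordinates of
    [T y] for every [y] in its domain, so that [T] is a restriction of [D]; two
    self-adjoint operators one of which restricts the other are equal. *)
Lemma diag_sqrt_unique (S T : operator (l2 R)) :
  opeq (opmul D D) S -> is_positive_sqrt S T -> opeq T D.
Proof.
move=> DDS [Tsa Tpos TTS]; have TTDD := opeq_trans TTS (opeq_sym DDS).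
have [_ [Tadj Tsym]] := Tsa.
have Tdelta j : opdom T (delta j) /\ T (delta j) = (w j)%:C *: delta j.
  have DDj : opdom (opmul D D) (delta j).
    split; first exact: wdom_delta.
    by rewrite diag_delta -[_ *: _]addr0; apply: opdomP (opdom0 _); exact: wdom_delta.
  have TTj : opdom (opmul T T) (delta j) by rewrite TTDD.1.
  split; first exact: TTj.1.
  apply: positive_sqrt_eigenvector => //.
  rewrite -[T (T _)]/(opmul T T _) TTDD.2//=.
  apply: l2_ext => i; rewrite l2Z -[wfun _ _ _]/(opmul D D _) opmul_wopE// deltaE.
  by case: eqVneq => [->|]; rewrite ?mulr0// mulrA -rmorphM.
have TsubD y : opdom T y -> opdom D y /\ T y = D y.
  move=> Ty; have : graph D (y, T y).
    rewrite wop_graphE => j /=; rewrite -[T y j]l2dot_delta_r.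
    rewrite -[l2dot _ _]/(hdot _ _) Tsym//; last exact: (Tdelta j).1.
    rewrite (Tdelta j).2 (linearZr_LR hdot) /= conj_real_complex.
    by rewrite -[hdot _ _]/(l2dot _ _) l2dot_delta_r.
  by case.
(* Conversely, y in the domain of D satisfies the condition that defines the
   domain of the adjoint of T, which is T itself. *)
split; last by move=> y /TsubD[].
apply/seteqP; split => y; first by move=> /TsubD[].
move=> Dy; apply/Tadj; exists (D y) => x /TsubD[Dx ->].
exact: diag_symmetric.
Qed.

End Diagonal.

End WeightedComposition.

(** * The counterexample *)

Section Example.
Context {R : realType}.
Implicit Types x y : l2 R.

Definition odd_weight (i : nat) : R := if odd i then i%:R else 0.

Lemma odd_weight_ge0 i : 0 <= odd_weight i.
Proof. by rewrite /odd_weight; case: ifP. Qed.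

(** The source of the nilpotency: of two consecutive weights one vanishes. *)
Lemma odd_weightM_succ i : odd_weight i * odd_weight i.+1 = 0.
Proof. by rewrite /odd_weight /=; case: ifP; rewrite (mul0r, mulr0). Qed.

Lemma odd_weight_unbounded (M : R) : exists i, M < odd_weight i.+1.
Proof.
have [n Mn] : exists n : nat, M < n%:R.
  by exists (Num.truncn `|M|).+1; rewrite (le_lt_trans (ler_norm M))// truncnS_gt.
exists n.*2; rewrite /odd_weight /= odd_double/= (lt_le_trans Mn)// ler_nat.
by rewrite -addnn -addnS leq_addr.
Qed.

(** Grouping the coordinates into the pairs [(2k, 2k+1)], this is the direct sum
    of the blocks [(2k+1) N] with [N] the 2 by 2 nilpotent Jordan block, whose
    adjoint and absolute value are the next two operators. *)
Definition pair_shift : operator (l2 R) := wop (fun i => odd_weight i.+1) succn.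
Definition pair_shift_adj : operator (l2 R) := wop odd_weight predn.
Definition pair_shift_abs : operator (l2 R) := wop odd_weight id.
(** The commutator of [pair_shift_abs] and [pair_shift]: the direct sum of the
    blocks [- (2k+1) ^ 2 N]. *)
Definition abs_commutator : operator (l2 R) :=
  wop (fun i => - odd_weight i.+1 ^+ 2) succn.

(** The two image sequences differ by a shift of the index. *)
Lemma pair_shift_abs_dom x : opdom pair_shift x <-> opdom pair_shift_abs x.
Proof.
split; first by move=> Cx; apply: square_summable_shift; exact: Cx.
move=> Ax; apply: (@square_summable_unshift _ (wseq odd_weight id x)).
exact: Ax.
Qed.

Lemma pair_shift_sqr_dom x :
  opdom pair_shift x -> opdom (opmul pair_shift pair_shift) x.
Proof.
move=> Cx; apply/opmul_wop_dom; split=> //.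
apply: (@square_summable_finite _ _ 0) => i _.
by rewrite mulrA -rmorphM odd_weightM_succ mul0r.
Qed.

Lemma pair_shift_adjoint : is_adjoint pair_shift pair_shift_adj.
Proof.
apply: wop_adjoint => [i|x y Cx Cy|j]; first exact: leqW.
  rewrite [RHS]/l2dot -csum_shift.
    congr csum; apply/funext => i; rewrite !wopE//= rmorphM /= conj_real_complex.
    by rewrite mulrAC mulrC mulrA.
  by rewrite wopE// /odd_weight /= mul0r conjC0 mulr0.
apply: l2_ext => i; rewrite wopE; last by apply: wdom_delta => k; exact: leqW.
rewrite l2Z !deltaE /odd_weight; case: j => [|j] /=.
  by rewrite mul0r mulr0.
rewrite eqSS; case: eqVneq => [->|]; by rewrite ?mulr0.
Qed.

(** On the block [k], both products are the projection on the coordinate [2k+1]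
    times [(2k+1) ^ 2]. *)
Lemma pair_shift_abs_sqr :
  opeq (opmul pair_shift_abs pair_shift_abs) (opmul pair_shift_adj pair_shift).
Proof.
have sqrE x : (fun i => (odd_weight i)%:C * ((odd_weight i)%:C * x i)) =
    (fun i => (odd_weight i)%:C * ((odd_weight i.-1.+1)%:C * x i.-1.+1)).
  by apply/funext => -[|i] //=; rewrite /odd_weight /= !mul0r.
have domE x : opdom (opmul pair_shift_abs pair_shift_abs) x <->
    opdom (opmul pair_shift_adj pair_shift) x.
  split=> /opmul_wop_dom[Dx DDx]; apply/opmul_wop_dom.
    split; first exact: (pair_shift_abs_dom x).2.
    exact: (eq_ind _ square_summable DDx _ (sqrE x)).
  split; first exact: (pair_shift_abs_dom x).1.
  exact: (eq_ind _ square_summable DDx _ (esym (sqrE x))).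
split.
  by apply/seteqP; split => x; [exact: (domE x).1|exact: (domE x).2].
move=> x AAx; have CCx := (domE x).1 AAx.
apply: l2_ext => i; rewrite (opmul_wopE i AAx) (opmul_wopE i CCx).
exact: (congr1 (@^~ i) (sqrE x)).
Qed.

Lemma pair_shift_absolute_value : is_absolute_value pair_shift pair_shift_abs.
Proof.
exists pair_shift_adj; split; first exact: pair_shift_adjoint.
  split; [exact: diag_self_adjoint| |exact: pair_shift_abs_sqr].
  exact/diag_positive/odd_weight_ge0.
by move=> T; apply: diag_sqrt_unique pair_shift_abs_sqr; exact: odd_weight_ge0.
Qed.

(** As [|C| C] vanishes, the difference is [- C |C|]. Its natural domain is no
    smaller than the maximal one because the weights are [0] or at least [1]:
    square-summability against the squared weights implies it against the
    weights themselves. *)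
Lemma abs_commutatorE :
  opeq (opsub (opmul pair_shift_abs pair_shift)
              (opmul pair_shift pair_shift_abs)) abs_commutator.
Proof.
have AC0 z i : (odd_weight i)%:C * ((odd_weight i.+1)%:C * z) = 0 :> R[i].
  by rewrite mulrA -rmorphM odd_weightM_succ mul0r.
apply: opeq_wop => [x|x i [ACx CAx]]; last first.
  rewrite -[LHS]/(opmul pair_shift_abs pair_shift x i -
                  opmul pair_shift pair_shift_abs x i).
  rewrite (opmul_wopE i ACx) (opmul_wopE i CAx) AC0 sub0r.
  by rewrite mulrA -rmorphM -mulNr -rmorphN -expr2.
split=> [[_ /opmul_wop_dom[_ CAx]]|Kx].
  rewrite /wdom /=; apply: square_summable_le CAx => i.
  by rewrite /wseq !sqmodM /= /sqmod /=; nra.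
have Cx : opdom pair_shift x.
  rewrite /= /wdom /=; apply: square_summable_le Kx => i.
  rewrite /wseq !sqmodM ler_wpM2r ?sqmod_ge0// /sqmod /= expr0n !addr0.
  rewrite sqrrN ler_sqr ?nnegrE ?exprn_ge0 ?odd_weight_ge0// /odd_weight; case: ifP => // _.
  by rewrite expr2 ler_peMr// ler1n.
split; apply/opmul_wop_dom; split.
- exact: Cx.
- by apply: (@square_summable_finite _ _ 0) => i _; exact: AC0.
- exact: (pair_shift_abs_dom x).1 Cx.
- apply: square_summable_le Kx => i.
  by rewrite /wseq !sqmodM /= /sqmod /=; nra.
Qed.

(** Since [0^-1 = 0], this is the sequence [0, 1, 1/2, 1/3, ...]; its image under
    [pair_shift] would be constantly [1] on even indices. *)
Definition inverse_seq (i : nat) : R[i] := (i%:R^-1)%:C.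

Fact inverse_seq_l2 : inverse_seq \in l2_pred.
Proof.
apply/l2_predP/square_summable_shift/(@square_summable_bounded _ _ 2) => n.
case: n => [|n]; first by rewrite /series /= big_geq.
(* 1/(i+1)^2 <= 1/i - 1/(i+1) for i > 0, and the right-hand side telescopes. *)
suff : series (fun i => sqmod (inverse_seq i.+1)) n.+1 <= 2 - n.+1%:R^-1.
  by move=> /le_trans; apply; rewrite gerBl invr_ge0.
elim: n => [|n IHn].
  rewrite seriesSr /series /= big_geq// /sqmod /= invr1 expr1n expr0n /=; lra.
rewrite seriesSr (le_trans (lerD IHn (lexx _)))// /sqmod /= expr0n addr0.
have n1 : 0 < n.+1%:R :> R by rewrite ltr0n.
have n2 : 0 < n.+2%:R :> R by rewrite ltr0n.
rewrite -subr_ge0.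
have -> : 2 - n.+2%:R^-1 - (2 - n.+1%:R^-1 + n.+2%:R^-1 ^+ 2) =
   (n.+1%:R * n.+2%:R ^+ 2)^-1 :> R.
  have n2E : n.+2%:R = n.+1%:R + 1 :> R by rewrite natr1.
  by move: n1 n2; rewrite n2E => n1 n2; field; rewrite !gt_eqF.
by rewrite invr_ge0 mulr_ge0 ?exprn_ge0// ltW.
Qed.

Lemma inverse_seq_notin_dom : ~ opdom pair_shift (L2 inverse_seq_l2).
Proof.
move=> Cx.
have /cvgrPdist_lt/(_ 1 ltr01)[N _ /(_ N.*2)] := cvg_series_cvg_0 Cx.
rewrite /= -addnn leq_addr => /(_ isT).
rewrite sub0r normrN /wseq addnn /odd_weight /= odd_double /= /inverse_seq -rmorphM /=.
by rewrite divff// /sqmod /= expr0n addr0 expr1n normr1 ltxx.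
Qed.

(** The difference vanishes on a dense domain; were it closed, this domain would
    be closed, hence the whole space. *)
Lemma pair_shift_commutator_not_closed :
  ~ closed_operator (opsub (opmul pair_shift pair_shift)
                           (opmul pair_shift pair_shift)).
Proof.
set T := opsub _ _ => Tcl.
have Dcl : closed (opdom T).
  by apply: closed_zero_operator_dom Tcl => x _; rewrite /= subrr.
have : dense (opdom pair_shift) by apply: wop_dense => i; exact: leqW.
move=> /(_ (~` opdom T)) [||x [nTx Cx]].
- by exists (L2 inverse_seq_l2) => -[[Cx _] _]; exact: inverse_seq_notin_dom Cx.
- exact: closed_openC.
- by apply: nTx; split; exact: pair_shift_sqr_dom.
Qed.

End Example.

Theorem proposition2p2 (R : realType) :
  exists (H : hilbertType R) (B C absC : operator H),
    [/\ densely_defined B, ~ bounded_operator B & closed_operator B] /\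
    [/\ densely_defined C, ~ bounded_operator C & closed_operator C] /\
    is_absolute_value C absC /\
    bounded_operator (opsub (opmul C B) (opmul B C)) /\
    ~ closed_operator (opsub (opmul C B) (opmul B C)) /\
    ~ bounded_operator (opsub (opmul absC B) (opmul B absC)) /\
    closed_operator (opsub (opmul absC B) (opmul B absC)).
Proof.
have le_succ i : (i <= i.+2)%N by exact: leqW.
have C_ok : [/\ densely_defined (@pair_shift R), ~ bounded_operator (@pair_shift R)
    & closed_operator (@pair_shift R)].
  split; [exact: wop_dense| |exact: wop_closed].
  apply: wop_unbounded => // M; have [i Mi] := odd_weight_unbounded M; exists i.
  by rewrite ger0_norm ?odd_weight_ge0.
exists (l2 R), pair_shift, pair_shift, pair_shift_abs.
split; first exact: C_ok.
split; first exact: C_ok.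
split; first exact: pair_shift_absolute_value.
split.
  by exists 0; split=> // x _; rewrite /= subrr normr0 mul0r.
split; first exact: pair_shift_commutator_not_closed.
split; last by apply: (opeq_closed abs_commutatorE); exact: wop_closed.
move=> /(opeq_bounded abs_commutatorE); apply: wop_unbounded => // M.
have [i Mi] := odd_weight_unbounded (`|M| + 1); exists i.
rewrite normrN ger0_norm ?exprn_ge0 ?odd_weight_ge0//.
have M0 := normr_ge0 M; have MM := ler_norm M.
by rewrite (le_lt_trans MM)//; nra.
Qed.
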